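(* Let $G=PU(2,1)$ act on $S^3$, and let $\bar\beta: C_3(S^3)_G\to\mathcal{P}(\mathbb{C})$ be the $\mathbb{Z}$-linear extension of the map sending a generic ordered quadruple $(p_0,p_1,p_2,p_3)$ of points of $S^3$ to $[z_{01}]+[z_{10}]+[z_{23}]+[z_{32}]$. Then $\bar\beta(\operatorname{Im}\bar d_4)=0$ in $\mathcal{P}(\mathbb{C})$, where $\bar d_4: C_4(S^3)_G\to C_3(S^3)_G$. (Consequently $\bar\beta$ induces a well-defined homomorphism $c: C_3(S^3)_G/\operatorname{Im}(\bar d_4)\to\mathcal{P}(\mathbb{C})$.)
   Context: Pre-Bloch group: for a field $F$, $\mathcal{P}(F)$ is the quotient of the free abelian group $\mathbb{Z}[F\setminus\{0,1\}]$ by the subgroup generated by $[x]-[y]+[\frac{y}{x}]-[\frac{1-x^{-1}}{1-y^{-1}}]+[\frac{1-x}{1-y}]$ for $x\neq y$ in $F\setminus\{0,1\}$. $\mathbb{C}^{2,1}$ is $\mathbb{C}^3$ with the Hermitian form $\langle z,w\rangle=w^*Jz$, $J=\begin{pmatrix}0&0&1\\0&1&0\\1&0&0\end{pmatrix}$. $S^3\subset\mathbb{C}P^2$ is the set of null lines $\{[z]: z\neq 0,\langle z,z\rangle=0\}$, and $PU(2,1)$ is the projectivization of the unitary group of this form. A $\mathbb{C}$-circle is the intersection with $S^3$ of a complex projective line which meets $S^3$ in more than one point. Points of $S^3$ ($n\ge 1$ of them) are generic if they are pairwise distinct and, when $n\ge3$, no three of them lie on a common $\mathbb{C}$-circle.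 $C_n(S^3)$ is the free abelian group on ordered generic $(n+1)$-tuples of points of $S^3$, with the diagonal $G$-action and $d_n(p_0,\dots,p_n)=\sum_{i=0}^n(-1)^i(p_0,\dots,\hat p_i,\dots,p_n)$. $C_n(S^3)_G$ denotes the group of $G$-coinvariants and $\bar d_n$ the induced map. Cross-ratio invariants: for a generic quadruple $(p_0,p_1,p_2,p_3)$, with lifts $\hat p_i\in\mathbb{C}^{2,1}$, and $(i,j,k,l)$ an even permutation of $(0,1,2,3)$, $$z_{ij}=\frac{\langle \hat p_l,c_{ij}\rangle\langle\hat p_k,\hat p_i\rangle}{\langle\hat p_k,c_{ij}\rangle\langle\hat p_l,\hat p_i\rangle},$$ where $c_{ij}\neq0$ is a vector with $\langle\hat p_i,c_{ij}\rangle=\langle\hat p_j,c_{ij}\rangle=0$. This lies in $\mathbb{C}\setminus\{0,1\}$ and is independent of the choices and $PU(2,1)$-invariant. *)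

(* Defs.v *)
From HB Require Import structures.
From mathcomp Require Import all_boot all_order all_algebra perm.
From mathcomp Require Import boolp classical_sets.
From mathcomp Require Import ring.
From mathcomp Require Import complex freeg.

Set Implicit Arguments.
Unset Strict Implicit.
Unset Printing Implicit Defensive.

Import Order.TTheory GRing.Theory Num.Theory.

Local Open Scope ring_scope.
Local Open Scope quotient_scope.
Local Open Scope classical_set_scope.

Section GeneratedSubgroup.
Variables (V : zmodType) (A : set V).

Definition subgroup_gen : {pred V} := fun x =>
  `[< forall H : zmodClosed V, (forall a, A a -> a \in H) -> x \in H >].

Lemma subgroup_genP x : reflect
  (forall H : zmodClosed V, (forall a, A a -> a \in H) -> x \in H)
  (x \in subgroup_gen).
Proof. exact: asboolP. Qed.

Lemma mem_subgroup_gen a : A a -> a \in subgroup_gen.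
Proof. by move=> Aa; apply/subgroup_genP => H; apply. Qed.

Fact subgroup_gen_zmod_closed : zmod_closed subgroup_gen.
Proof.
split=> [|x y /subgroup_genP Hx /subgroup_genP Hy]; apply/subgroup_genP => H AH.
  exact: rpred0.
by rewrite rpredB ?Hx ?Hy.
Qed.
HB.instance Definition _ :=
  GRing.isZmodClosed.Build V subgroup_gen subgroup_gen_zmod_closed.

Definition abquot := Quotient.quot subgroup_gen.
HB.instance Definition _ := GRing.Zmodule.on abquot.
HB.instance Definition _ :
  isZmodQuotient V (Quotient.equiv subgroup_gen) 0 -%R +%R abquot :=
  ZmodQuotient.on abquot.

Lemma abquot_eq (x y : V) :
  (\pi_abquot x = \pi_abquot y) <-> (x - y \in subgroup_gen).
Proof.
rewrite -[_ \in _]/(Quotient.equiv subgroup_gen x y); split.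
  by move/eqmodP.
by move=> h; apply/eqmodP.
Qed.

End GeneratedSubgroup.

Section QuotientMap.
Variables (V W : zmodType) (A : set V) (f : {additive V -> W}).

(* The map induced by [f] on V / <A>; meaningful when [f] vanishes on [A]. *)
Definition abquot_map : abquot A -> W := fun x => f (repr x).

Hypothesis fA : forall a, A a -> f a = 0.

Lemma subgroup_gen_ker x : x \in subgroup_gen A -> f x = 0.
Proof.
pose K : {pred V} := fun x => f x == 0.
have Kz : zmod_closed K.
  split=> [|y z]; rewrite !unfold_in ?raddf0 //.
  by move=> /eqP fy /eqP fz; rewrite raddfB fy fz subr0.
pose KK := GRing.isZmodClosed.Build V K Kz.
pose KZ : zmodClosed V := HB.pack K KK.
move/subgroup_genP/(_ KZ) => h; apply/eqP/h => a /fA fa.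
by rewrite unfold_in /= /K fa.
Qed.

Lemma abquot_mapE x : abquot_map (\pi_(abquot A) x) = f x.
Proof.
apply/eqP; rewrite -subr_eq0 -raddfB; apply/eqP/subgroup_gen_ker.
by apply/abquot_eq; rewrite reprK.
Qed.

Lemma abquot_map_zmod_morphism : zmod_morphism abquot_map.
Proof.
move=> x y; rewrite -[x]reprK -[y]reprK.
have -> : \pi_(abquot A) (repr x) - \pi_(abquot A) (repr y)
        = \pi_(abquot A) (repr x - repr y).
  by rewrite raddfB.
by rewrite !abquot_mapE raddfB.
Qed.

End QuotientMap.

Section FreeAbelianGroup.
Variables (K : choiceType) (M : zmodType).

(* [zmodule M] is [M] seen as a module over [int]. *)
Definition fgext (f : K -> M) : {freeg K} -> M :=
  fun D => fglift (f : K -> zmodule M) D.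

Fact fgext_zmod_morphism f : zmod_morphism (fgext f).
Proof. by move=> x y; exact: (@lift_is_additive int K (zmodule M) f x y). Qed.
HB.instance Definition _ f :=
  GRing.isZmodMorphism.Build {freeg K} M (fgext f) (fgext_zmod_morphism f).

Lemma fgextU f k : fgext f << k >> = f k.
Proof. by rewrite /fgext liftU scale1r. Qed.

Lemma fgextUz f (n : int) k : fgext f << n *g k >> = f k *~ n.
Proof. by rewrite /fgext liftU. Qed.

Lemma additive_freeg_ext (f g : {additive {freeg K} -> M}) :
  (forall k, f << k >> = g << k >>) -> f =1 g.
Proof.
move=> fg D; rewrite -[D]freeg_sumE !raddf_sum; apply: eq_bigr => k _.
have -> : << coeff k D *g k >> = << k >> *~ coeff k D :> {freeg K}.
  by rewrite freegU_mulz intz.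
by rewrite !raddfMz fg.
Qed.

End FreeAbelianGroup.

Section Coinvariants.
Variables (G : groupType) (M : zmodType) (act : G -> M -> M).

Definition coinv_rel : set M := [set x | exists g m, x = act g m - m].

Definition coinvariants := abquot coinv_rel.
HB.instance Definition _ := ZmodQuotient.on coinvariants.

End Coinvariants.

Section PreBloch.
Variable F : fieldType.

Definition is_F01 : pred F := fun x => (x != 0) && (x != 1).
Record F01 := MkF01 { F01_val :> F; F01P : is_F01 F01_val }.
HB.instance Definition _ := [isSub for F01_val].
HB.instance Definition _ := [Choice of F01 by <:].

(* The symbol [x] in Z[F \ {0,1}]. It is only ever used for [x] in F \ {0,1},
   see [five_term_F01] and [zinv_F01]; outside it is 0 by convention. *)
Definition fsymb (x : F) : {freeg F01} :=
  if insub x is Some u then << u >> else 0.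

Definition five_term (x y : F) : {freeg F01} :=
  fsymb x - fsymb y + fsymb (y / x)
  - fsymb ((1 - x^-1) / (1 - y^-1)) + fsymb ((1 - x) / (1 - y)).

Lemma five_term_F01 (x y : F) : is_F01 x -> is_F01 y -> x != y ->
  [/\ is_F01 (y / x), is_F01 ((1 - x^-1) / (1 - y^-1))
    & is_F01 ((1 - x) / (1 - y))].
Proof.
rewrite /is_F01 => /andP[x0 x1] /andP[y0 y1] xy.
have nz (a : F) : a != 1 -> 1 - a != 0 by rewrite subr_eq0 eq_sym.
have nzV (a : F) : a != 1 -> 1 - a^-1 != 0.
  by move=> a1; rewrite subr_eq0 eq_sym invr_eq1.
have div (a b : F) : a != 0 -> b != 0 -> a != b -> is_F01 (a / b).
  move=> a0 b0 ab; rewrite /is_F01 mulf_neq0 ?invr_eq0 //=.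
  by apply: contra ab => /eqP h; rewrite -[a](divfK b0) h mul1r.
split; apply: div; rewrite ?x0 ?y0 1?[y == x]eq_sym //.
- exact: nzV.
- exact: nzV.
- by rewrite (inj_eq (addrI 1)) eqr_opp (inj_eq invr_inj).
- exact: nz.
- exact: nz.
- by rewrite (inj_eq (addrI 1)) eqr_opp.
Qed.

Definition five_term_rel : set {freeg F01} :=
  [set r | exists x y : F01, x != y /\ r = five_term x y].

Definition preBloch := abquot five_term_rel.
HB.instance Definition _ := ZmodQuotient.on preBloch.

Definition bsymb (x : F) : preBloch := \pi_preBloch (fsymb x).

End PreBloch.

Section Hermitian.
Variable C : numClosedFieldType.
Local Notation cV := 'cV[C]_3.

Definition J21 : 'M[C]_3 := \matrix_(i, j) (i + j == 2)%N%:R.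

Definition adjmx m n (A : 'M[C]_(m, n)) : 'M[C]_(n, m) :=
  (map_mx Num.conj A)^T.

Definition herm (z w : cV) : C := (adjmx w *m J21 *m z) 0 0.

Lemma adjmxM m n p (A : 'M[C]_(m, n)) (B : 'M_(n, p)) :
  adjmx (A *m B) = adjmx B *m adjmx A.
Proof. by rewrite /adjmx map_mxM trmx_mul. Qed.

Lemma adjmxK m n (A : 'M[C]_(m, n)) : adjmx (adjmx A) = A.
Proof. by apply/matrixP => i j; rewrite !mxE conjCK. Qed.

Lemma adjmx_J : adjmx J21 = J21.
Proof. by apply/matrixP => i j; rewrite !mxE conjC_nat addnC. Qed.

Lemma J21_sqr : J21 *m J21 = 1%:M.
Proof.
apply/matrixP => i j; rewrite !mxE !big_ord_recl big_ord0 !mxE.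
by case: i => [[|[|[|i]]] hi] //; case: j => [[|[|[|j]]] hj] //=;
  rewrite -?[1 == 2]/false ?mulr0 ?mul0r ?mul1r ?addr0 ?add0r.
Qed.

Lemma hermE (z w : cV) : herm z w =
  z 0 0 * (w 2 0)^* + z 1 0 * (w 1 0)^* + z 2 0 * (w 0 0)^*.
Proof.
rewrite /herm -mulmxA mxE !big_ord_recl big_ord0 !mxE.
rewrite !big_ord_recl !big_ord0 !mxE /=.
have e0 : ord0 = 0 :> 'I_3 by exact: val_inj.
have e1 : fintype.lift ord0 ord0 = 1 :> 'I_3 by exact: val_inj.
have e2 : fintype.lift ord0 (fintype.lift ord0 ord0) = 2 :> 'I_3 by exact: val_inj.
rewrite !e0 !e1 !e2 /bump /=.
by rewrite ?(mul0r, mul1r, addr0, add0r); ring.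
Qed.

Lemma hermDl z z' w : herm (z + z') w = herm z w + herm z' w.
Proof. by rewrite /herm mulmxDr mxE. Qed.
Lemma hermZl a z w : herm (a *: z) w = a * herm z w.
Proof. by rewrite /herm -scalemxAr mxE. Qed.
Lemma herm_sym z w : herm z w = (herm w z)^*.
Proof. by rewrite !hermE !rmorphD !rmorphM /= !conjCK; ring. Qed.
Lemma hermDr z w w' : herm z (w + w') = herm z w + herm z w'.
Proof. by rewrite herm_sym hermDl rmorphD /= -!herm_sym. Qed.
Lemma hermZr a z w : herm z (a *: w) = a^* * herm z w.
Proof. by rewrite herm_sym hermZl rmorphM /= -herm_sym. Qed.

Definition is_U21 : pred 'M[C]_3 := fun A => adjmx A *m J21 *m A == J21.
Record U21 := MkU21 { U21_mx :> 'M[C]_3; U21P : is_U21 U21_mx }.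
HB.instance Definition _ := [isSub for U21_mx].
HB.instance Definition _ := [Choice of U21 by <:].

Lemma herm_U21 (A : U21) z w : herm (A *m z) (A *m w) = herm z w.
Proof.
rewrite /herm adjmxM.
have -> : adjmx w *m adjmx A *m J21 *m (A *m z)
       = adjmx w *m (adjmx A *m J21 *m A) *m z by rewrite !mulmxA.
by rewrite (eqP (U21P A)).
Qed.

Fact U21_one_subproof : is_U21 1%:M.
Proof. by rewrite /is_U21 mulmx1 /adjmx map_mx1 trmx1 mul1mx. Qed.
Definition U21_one := MkU21 U21_one_subproof.

Fact U21_mul_subproof (A B : U21) : is_U21 (A *m B).
Proof.
rewrite /is_U21 adjmxM.
have -> : adjmx B *m adjmx A *m J21 *m (A *m B)
       = adjmx B *m (adjmx A *m J21 *m A) *m B by rewrite !mulmxA.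
rewrite (eqP (U21P A)); exact: U21P.
Qed.
Definition U21_mul A B := MkU21 (U21_mul_subproof A B).

Lemma U21_mulVmx (A : U21) : (J21 *m adjmx A *m J21) *m A = 1%:M.
Proof. by rewrite -2!mulmxA [adjmx A *m _]mulmxA (eqP (U21P A)) J21_sqr. Qed.

Fact U21_inv_subproof (A : U21) : is_U21 (J21 *m adjmx A *m J21).
Proof.
have h := mulmx1C (U21_mulVmx A).
rewrite /is_U21 !adjmxM adjmxK adjmx_J.
have -> : J21 *m (A *m J21) *m J21 *m (J21 *m adjmx A *m J21)
       = J21 *m A *m (J21 *m J21) *m (J21 *m adjmx A *m J21).
  by rewrite !mulmxA.
by rewrite J21_sqr mulmx1 -mulmxA h mulmx1.
Qed.
Definition U21_inv A := MkU21 (U21_inv_subproof A).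

Fact U21_mulA : associative U21_mul.
Proof. by move=> A B D; apply: val_inj; rewrite /= mulmxA. Qed.
Fact U21_mul1 : left_id U21_one U21_mul.
Proof. by move=> A; apply: val_inj; rewrite /= mul1mx. Qed.
Fact U21_1mul : right_id U21_one U21_mul.
Proof. by move=> A; apply: val_inj; rewrite /= mulmx1. Qed.
Fact U21_mulV : left_inverse U21_one U21_inv U21_mul.
Proof. by move=> A; apply: val_inj; rewrite /= U21_mulVmx. Qed.
Fact U21_Vmul : right_inverse U21_one U21_inv U21_mul.
Proof. by move=> A; apply: val_inj; rewrite /= (mulmx1C (U21_mulVmx A)). Qed.
HB.instance Definition _ :=
  isGroup.Build U21 U21_mulA U21_mul1 U21_1mul U21_mulV U21_Vmul.

Lemma U21_unit (A : U21) : (A : 'M_3) \in unitmx.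
Proof. by have [] := mulmx1_unit (U21_mulVmx A). Qed.

Lemma U21_mul_eq0 (A : U21) (z : cV) : (A *m z == 0) = (z == 0).
Proof.
apply/eqP/eqP => [h|->]; last exact: mulmx0.
by rewrite -[z](mulKmx (U21_unit A)) h mulmx0.
Qed.

Definition projeq (A B : U21) : bool :=
  `[< exists c : C, (B : 'M_3) = c *: (A : 'M_3) >].

Lemma projeqP (A B : U21) : reflect
  (exists2 c : C, c != 0 & (B : 'M_3) = c *: (A : 'M_3)) (projeq A B).
Proof.
apply: (iffP (asboolP _)) => [[c e]|[c _ e]]; exists c => //.
apply: contraTneq (U21_unit B) => c0; rewrite e c0 scale0r unitmxE det0.
by rewrite unitr0.
Qed.

Fact projeq_equiv : equiv_class_of projeq.
Proof.
have sym A B : projeq A B -> projeq B A.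
  case/projeqP => c c0 e; apply/projeqP; exists c^-1; rewrite ?invr_eq0 //.
  by rewrite e scalerA mulVf ?scale1r.
split=> [A|A B|B A D].
- by apply/projeqP; exists 1; rewrite ?oner_eq0 ?scale1r.
- by apply/idP/idP => /sym.
- case/projeqP => c c0 eB /projeqP[d d0 eD].
  apply/projeqP; exists (d * c); rewrite ?mulf_neq0 //.
  by rewrite eD eB scalerA.
Qed.
Canonical projeq_equiv_rel := EquivRelPack projeq_equiv.
Canonical projeq_encModRel := defaultEncModRel projeq.

Definition PU21 := {eq_quot projeq}.
HB.instance Definition _ := EqQuotient.on PU21.
HB.instance Definition _ := Choice.on PU21.

Lemma PU21_eqP (A B : U21) : (\pi_PU21 A = \pi_PU21 B) <-> projeq A B.
Proof. by split=> [/eqmodP|?]; [|apply/eqmodP]. Qed.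

Definition PU21_one : PU21 := \pi_PU21 (1%g : U21).
Definition PU21_mul (g h : PU21) : PU21 := \pi_PU21 ((repr g : U21) * repr h)%g.
Definition PU21_inv (g : PU21) : PU21 := \pi_PU21 ((repr g : U21)^-1)%g.

Lemma PU21_pi_mul (A B : U21) :
  PU21_mul (\pi_PU21 A) (\pi_PU21 B) = \pi_PU21 (A * B)%g.
Proof.
rewrite /PU21_mul; apply/PU21_eqP.
have /PU21_eqP/projeqP[c c0 ec] := reprK (\pi_PU21 A).
have /PU21_eqP/projeqP[d d0 ed] := reprK (\pi_PU21 B).
apply/projeqP; exists (c * d); rewrite ?mulf_neq0 //=.
by rewrite ec ed -scalemxAl -scalemxAr scalerA.
Qed.

Lemma PU21_pi_inv (A : U21) : PU21_inv (\pi_PU21 A) = \pi_PU21 (A^-1)%g.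
Proof.
rewrite /PU21_inv; apply/PU21_eqP.
have /PU21_eqP/projeqP[c c0 ec] := reprK (\pi_PU21 A).
apply/projeqP; exists c^*; rewrite ?conjC_eq0 //=.
by rewrite ec /adjmx map_mxZ linearZ /= -scalemxAr -scalemxAl.
Qed.

Fact PU21_mulA : associative PU21_mul.
Proof.
elim/quotW=> A; elim/quotW=> B; elim/quotW=> D.
by rewrite (PU21_pi_mul B D) (PU21_pi_mul A B) (PU21_pi_mul A (B * D)%g)
  (PU21_pi_mul (A * B)%g D) mulgA.
Qed.
Fact PU21_mul1 : left_id PU21_one PU21_mul.
Proof. by elim/quotW=> A; rewrite (PU21_pi_mul 1%g A) mul1g. Qed.
Fact PU21_1mul : right_id PU21_one PU21_mul.
Proof. by elim/quotW=> A; rewrite (PU21_pi_mul A 1%g) mulg1. Qed.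
Fact PU21_mulV : left_inverse PU21_one PU21_inv PU21_mul.
Proof.
by elim/quotW=> A; rewrite (PU21_pi_inv A) (PU21_pi_mul A^-1%g A) mulVg.
Qed.
Fact PU21_Vmul : right_inverse PU21_one PU21_inv PU21_mul.
Proof.
by elim/quotW=> A; rewrite (PU21_pi_inv A) (PU21_pi_mul A A^-1%g) mulgV.
Qed.
HB.instance Definition _ :=
  isGroup.Build PU21 PU21_mulA PU21_mul1 PU21_1mul PU21_mulV PU21_Vmul.

(* Points of CP^2 are one-dimensional subspaces of C^3. *)

Definition null_line (L : {vspace cV}) : bool :=
  `[< exists z : cV, [/\ z != 0, herm z z = 0 & L = <[z]>%VS] >].
Record S3 := MkS3 { S3_line :> {vspace cV}; S3P : null_line S3_line }.
HB.instance Definition _ := [isSub for S3_line].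
HB.instance Definition _ := [Choice of S3 by <:].

Lemma S3_lift (p : S3) :
  exists z : cV, [/\ z != 0, herm z z = 0 & S3_line p = <[z]>%VS].
Proof. exact/asboolP/S3P. Qed.

Lemma limg_U21_line (A : U21) (z : cV) :
  (linfun (mulmx A) @: <[z]> = <[A *m z]>)%VS.
Proof. by rewrite limg_line lfunE. Qed.

Fact S3_U21_subproof (A : U21) (p : S3) :
  null_line (linfun (mulmx A) @: S3_line p)%VS.
Proof.
have [z [z0 zz ->]] := S3_lift p; apply/asboolP; exists (A *m z).
by rewrite U21_mul_eq0 herm_U21 limg_U21_line.
Qed.
Definition S3_U21 (A : U21) (p : S3) : S3 := MkS3 (S3_U21_subproof A p).

Lemma S3_U21E (A : U21) (p : S3) (z : cV) :
  S3_line p = <[z]>%VS -> S3_line (S3_U21 A p) = <[A *m z]>%VS.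
Proof.
move=> e; have -> : S3_line (S3_U21 A p) = (linfun (mulmx A) @: S3_line p)%VS.
  by [].
by rewrite e limg_U21_line.
Qed.

Lemma vline_scale (c : C) (z : cV) : c != 0 -> <[c *: z]>%VS = <[z]>%VS.
Proof.
move=> c0; apply/eqP; rewrite eqEsubv -!memvE memvZ ?memv_line //=.
by rewrite -[X in X \in _](scalerK c0) memvZ ?memv_line.
Qed.

Definition S3_act (g : PU21) (p : S3) : S3 := S3_U21 (repr g) p.

(* [S3_act] does not depend on the matrix representing [g]. *)
Lemma S3_act_pi (A : U21) p : S3_act (\pi_PU21 A) p = S3_U21 A p.
Proof.
apply: val_inj; have [z [_ _ e]] := S3_lift p.
rewrite [LHS](S3_U21E _ e) [RHS](S3_U21E _ e).
have /PU21_eqP/projeqP[c c0 ->] := reprK (\pi_PU21 A).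
by rewrite -scalemxAl vline_scale ?invr_eq0.
Qed.

Lemma S3_act1 p : S3_act 1%g p = p.
Proof.
rewrite -[1%g]/PU21_one /PU21_one S3_act_pi; apply: val_inj.
by have [z [_ _ e]] := S3_lift p; rewrite [LHS](S3_U21E _ e) mul1mx.
Qed.

Lemma S3_actM g h p : S3_act (g * h)%g p = S3_act g (S3_act h p).
Proof.
elim/quotW: g => A; elim/quotW: h => B.
rewrite [(_ * _)%g](PU21_pi_mul A B) !S3_act_pi.
apply: val_inj; have [z [_ _ e]] := S3_lift p.
by rewrite [LHS](S3_U21E _ e) [RHS](S3_U21E _ (S3_U21E _ e)) mulmxA.
Qed.

Lemma S3_act_inj g : injective (S3_act g).
Proof. by apply: can_inj (S3_act g^-1%g) _ => p; rewrite -S3_actM mulVg S3_act1. Qed.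

(* The points of S^3 on the complex projective line P(W), for dim W = 2. *)
Definition trace_S3 (W : {vspace cV}) : set S3 :=
  [set p | (S3_line p <= W)%VS].

Definition Ccircle (K : set S3) : Prop :=
  exists W : {vspace cV}, [/\ \dim W = 2%N, K = trace_S3 W
    & exists p q : S3, [/\ K p, K q & p != q]].

Definition cocircular (p q r : S3) : Prop :=
  exists K, [/\ Ccircle K, K p, K q & K r].

(* For n < 3 the second clause is vacuous. *)
Definition generic n (p : 'I_n -> S3) : Prop :=
  injective p /\
  forall i j k : 'I_n, i != j -> i != k -> j != k ->
    ~ cocircular (p i) (p j) (p k).

End Hermitian.

Section Geometry.
Variable C : numClosedFieldType.
Local Notation cV := 'cV[C]_3.
Local Notation S3 := (S3 C).
Local Notation PU21 := (PU21 C).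

Lemma Ccircle3P (p q r : S3) : p != q ->
  cocircular p q r <->
  (exists W : {vspace cV}, [/\ \dim W = 2%N, (S3_line p <= W)%VS,
     (S3_line q <= W)%VS & (S3_line r <= W)%VS]).
Proof.
move=> pq; split=> [[K [[W [dW -> _]] Wp Wq Wr]]|[W [dW Wp Wq Wr]]].
  by exists W.
exists (trace_S3 W); split=> //; exists W; split=> //; exists p, q; split=> //.
Qed.

Lemma generic_act (g : PU21) n (p : 'I_n -> S3) :
  generic p -> generic (fun i => S3_act g (p i)).
Proof.
elim/quotW: g => A [p_inj gp]; split=> [i j /S3_act_inj/p_inj //|].
move=> i j k ij ik jk.
have gij : S3_act (\pi_PU21 A) (p i) != S3_act (\pi_PU21 A) (p j).
  by rewrite (inj_eq (@S3_act_inj _ _)) (inj_eq p_inj).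
move/(Ccircle3P _ gij) => [W [dW Wi Wj Wk]]; apply: (gp i j k ij ik jk).
apply/Ccircle3P; first by rewrite (inj_eq p_inj).
pose f : 'Hom(cV, cV) := linfun (mulmx (invmx A)).
have f0 : lker f == 0%VS.
  apply/lker0P => u v; rewrite !lfunE /= => e.
  by rewrite -[u](mulKVmx (U21_unit A)) e mulKVmx ?U21_unit.
have fW l : (S3_line (S3_act (\pi_PU21 A) (p l)) <= W)%VS ->
    (S3_line (p l) <= f @: W)%VS.
  rewrite S3_act_pi; have [z [_ _ e]] := S3_lift (p l).
  rewrite (S3_U21E _ e) e => /(limgS f); rewrite limg_line lfunE /=.
  by rewrite mulKmx ?U21_unit.
exists (f @: W)%VS; split; rewrite ?fW //.
by rewrite limg_dim_eq // (eqP f0) capv0.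
Qed.

Lemma generic_comp n m (h : 'I_m -> 'I_n) (p : 'I_n -> S3) :
  injective h -> generic p -> generic (p \o h).
Proof.
move=> h_inj [p_inj gp]; split=> [|i j k ij ik jk]; first exact: inj_comp.
by apply: gp; rewrite (inj_eq h_inj).
Qed.

Lemma herm0l (w : cV) : herm 0 w = 0.
Proof. by rewrite -[0](scale0r 0) hermZl mul0r. Qed.
Lemma herm0r (w : cV) : herm w 0 = 0.
Proof. by rewrite herm_sym herm0l conjC0. Qed.

Lemma cV3P (z w : cV) :
  z 0 0 = w 0 0 -> z 1 0 = w 1 0 -> z 2 0 = w 2 0 -> z = w.
Proof.
move=> e0 e1 e2; apply/colP => i.
have : [|| i == 0, i == 1 | i == 2] by case: i => [[|[|[|i]]] hi].
by case/or3P => /eqP ->.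
Qed.

Lemma herm_nondeg (d : cV) : (forall x, herm x d = 0) -> d = 0.
Proof.
move=> h; have e i : (J21 C *m d) i 0 = 0.
  have := h (delta_mx i 0); rewrite herm_sym => /eqP; rewrite conjC_eq0 => /eqP.
  rewrite /herm -mulmxA mxE (bigD1 i) //= big1 => [|j ji].
    by rewrite addr0 !mxE !eqxx conjC1 mul1r.
  by rewrite !mxE (negbTE ji) conjC0 mul0r.
have : J21 C *m d = 0 by apply/colP => i; rewrite e mxE.
by move/(congr1 (mulmx (J21 C))); rewrite mulmxA J21_sqr mul1mx mulmx0.
Qed.

Lemma null_col2 (z : cV) : herm z z = 0 -> z 2 0 = 0 -> z 1 0 = 0.
Proof.
rewrite hermE => + z2; rewrite z2 mul0r addr0 conjC0 mulr0 add0r => /eqP.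
by rewrite mul_conjC_eq0 => /eqP.
Qed.

Lemma null_orth (z w : cV) : z != 0 -> herm z z = 0 -> herm w w = 0 ->
  herm z w = 0 -> exists a, w = a *: z.
Proof.
move=> z0 zz ww zw; have wz : herm w z = 0 by rewrite herm_sym zw conjC0.
have [z2|z2] := eqVneq (z 2 0) 0.
  have z1 := null_col2 zz z2.
  have z0' : z 0 0 != 0.
    by apply: contra z0 => /eqP h; apply/eqP/cV3P; rewrite mxE.
  have w2 : w 2 0 = 0.
    move: zw; rewrite hermE z1 z2 !mul0r !addr0 => /eqP.
    by rewrite mulf_eq0 (negbTE z0') conjC_eq0 => /eqP.
  have w1 := null_col2 ww w2.
  exists (w 0 0 / z 0 0); apply: cV3P; rewrite mxE ?z1 ?z2 ?w1 ?w2 ?mulr0 //.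
  by rewrite divfK.
pose a := w 2 0 / z 2 0; pose u := w + (- a) *: z.
have uu : herm u u = 0.
  by rewrite !(hermDl, hermDr, hermZl, hermZr) zz ww zw wz !mulr0 !addr0.
have u2 : u 2 0 = 0 by rewrite !mxE mulNr divfK // subrr.
have u1 := null_col2 uu u2.
have zu : herm z u = 0 by rewrite hermDr hermZr zz zw mulr0 addr0.
have u0 : u 0 0 = 0.
  move: zu; rewrite hermE u1 u2 !conjC0 !mulr0 !add0r => /eqP.
  by rewrite mulf_eq0 (negbTE z2) conjC_eq0 => /eqP.
exists a; apply/eqP; rewrite -subr_eq0 -scaleNr; apply/eqP.
by apply: cV3P; rewrite ?[RHS]mxE.
Qed.

Definition herm_perp (c : cV) : {vspace cV} := lker (linfun (mulmx (adjmx c *m J21 C))).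

Lemma mem_herm_perp c z : (z \in herm_perp c) = (herm z c == 0).
Proof.
rewrite memv_ker lfunE /= /herm; apply/eqP/eqP => [->|h]; first by rewrite mxE.
by apply/matrixP => i j; rewrite !ord1 h mxE.
Qed.

Lemma dim_herm_perp c : c != 0 -> \dim (herm_perp c) = 2%N.
Proof.
move=> c0; pose f : 'Hom(cV, 'M[C]_1) := linfun (mulmx (adjmx c *m J21 C)).
have := limg_ker_dim f fullv; rewrite capfv -/(herm_perp c) dimvf /=.
suff -> : \dim (limg f) = 1%N by rewrite addn1 => -[].
apply/eqP; rewrite eqn_leq; apply/andP; split.
  by rewrite (leq_trans (dimvS (subvf _))) // dimvf.
rewrite lt0n dimv_eq0; apply: contra c0 => /eqP f0; apply/eqP/herm_nondeg => x.
have : f x \in limg f by rewrite memv_img ?memvf.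
by rewrite f0 memv0 -memv_ker mem_herm_perp => /eqP.
Qed.

Lemma dim_two_lines (z w : cV) : z != 0 -> <[z]>%VS <> <[w]>%VS -> w != 0 ->
  \dim (<[z]> + <[w]>)%VS = 2%N.
Proof.
move=> z0 zw w0; rewrite dimv_disjoint_sum ?dim_vline ?z0 ?w0 //.
apply/eqP; rewrite -subv0; apply/subvP => x; rewrite memv_cap.
case/andP => /vlineP[a ->] /vlineP[b e]; rewrite memv0.
have [->|a0] := eqVneq a 0; first by rewrite scale0r.
case: zw; rewrite -(vline_scale z a0) e vline_scale //.
apply: contraNneq a0 => b0; move/eqP: e.
by rewrite b0 scale0r scaler_eq0 (negbTE z0) orbF => /eqP ->.
Qed.

Lemma herm_perp_two (z w c : cV) : z != 0 -> w != 0 -> <[z]>%VS <> <[w]>%VS ->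
  c != 0 -> herm z c = 0 -> herm w c = 0 -> herm_perp c = (<[z]> + <[w]>)%VS.
Proof.
move=> z0 w0 zw c0 zc wc; apply/esym/eqP.
rewrite eqEdim dim_herm_perp // dim_two_lines // leqnn andbT subv_add -!memvE.
by rewrite !mem_herm_perp zc wc !eqxx.
Qed.

Lemma polar_unique (z w c d : cV) : z != 0 -> w != 0 ->
  <[z]>%VS <> <[w]>%VS -> c != 0 -> herm z c = 0 -> herm w c = 0 ->
  d != 0 -> herm z d = 0 -> herm w d = 0 ->
  exists2 a, a != 0 & d = a *: c.
Proof.
move=> z0 w0 zw c0 zc wc d0 zd wd.
have cd : herm_perp c = herm_perp d.
  by rewrite (herm_perp_two z0 w0 zw c0) // (herm_perp_two z0 w0 zw d0).
have [x xc] : exists x, herm x c != 0.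
  apply/not_existsP => h; case/negP: c0; apply/eqP/herm_nondeg => x.
  by apply/eqP; apply: contra_notT (h x).
pose a := (herm x d / herm x c)^*.
have e : d = a *: c.
  apply/eqP; rewrite -subr_eq0 -scaleNr; apply/eqP/herm_nondeg => y.
  have : y - (herm y c / herm x c) *: x \in herm_perp c.
    by rewrite mem_herm_perp -scaleNr hermDl hermZl mulNr divfK ?subrr.
  rewrite cd mem_herm_perp -scaleNr hermDl hermZl => /eqP h.
  rewrite hermDr hermZr rmorphN /= conjCK; rewrite -[RHS]h.
  by congr (_ + _); rewrite !mulNr; congr (- _); field.
exists a => //; apply: contraNneq d0 => a0.
by rewrite e a0 scale0r.
Qed.

Lemma polar_exists (z w : cV) : exists c : cV,
  [/\ c != 0, herm z c = 0 & herm w c = 0].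
Proof.
pose f : 'Hom(cV, 'cV[C]_(1 + 1)) :=
  linfun (mulmx (col_mx (adjmx z *m J21 C) (adjmx w *m J21 C))).
have : lker f != 0%VS.
  rewrite -dimv_eq0; apply/negP => /eqP k0.
  have := limg_ker_dim f fullv; rewrite capfv k0 add0n dimvf /= => h.
  by have := dimvS (subvf (limg f)); rewrite h dimvf.
move/negbTE; rewrite -subv0 => /negbT/subvPn[c].
rewrite memv_ker memv0 lfunE /= => fc c0; exists c.
move/eqP: fc; rewrite mul_col_mx -[0]vsubmxK => /eq_col_mx[fz fw].
by split=> //; rewrite herm_sym /herm ?fz ?fw !mxE conjC0.
Qed.

Definition crossr (zi zk zl c : cV) : C :=
  (herm zl c * herm zk zi) / (herm zk c * herm zl zi).

Definition polar (zi zj : cV) : cV :=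
  xget 0 [set c : cV | [/\ c != 0, herm zi c = 0 & herm zj c = 0]].

Definition cross_ratio (pi pj pk pl : S3) : C :=
  let hat (p : S3) : cV := vpick (S3_line p) in
  crossr (hat pi) (hat pk) (hat pl) (polar (hat pi) (hat pj)).

Lemma polarP (zi zj : cV) :
  [/\ polar zi zj != 0, herm zi (polar zi zj) = 0 & herm zj (polar zi zj) = 0].
Proof.
have [c Pc] := polar_exists zi zj.
exact: (@xgetI _ 0 [set c : cV | [/\ c != 0, herm zi c = 0 & herm zj c = 0]] c).
Qed.

Lemma vpick_line (z : cV) : z != 0 -> exists2 a, a != 0 & vpick <[z]> = a *: z.
Proof.
move=> z0; have /vlineP[a e] := memv_pick <[z]>%VS; exists a => //.
apply: contraNneq z0 => a0; move/eqP: e; rewrite a0 scale0r vpick0.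
by rewrite -subv0 -memvE memv0.
Qed.

Lemma crossr_scale (zi zk zl c : cV) (ai ak al ac : C) :
  ai != 0 -> ak != 0 -> al != 0 -> ac != 0 ->
  crossr (ai *: zi) (ak *: zk) (al *: zl) (ac *: c) = crossr zi zk zl c.
Proof.
move=> i0 k0 l0 c0; rewrite /crossr !(hermZl, hermZr).
have [->|h1] := eqVneq (herm zk c) 0; first by rewrite !(mulr0, mul0r) !invr0 !mulr0.
have [->|h2] := eqVneq (herm zl zi) 0; first by rewrite !(mulr0, mul0r) !invr0 !mulr0.
by field; rewrite h1 h2 k0 l0 !conjC_eq0 i0 c0.
Qed.

Lemma cross_ratioE (pi pj pk pl : S3) (zi zj zk zl c : cV) :
  pi != pj -> S3_line pi = <[zi]>%VS -> S3_line pj = <[zj]>%VS ->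
  S3_line pk = <[zk]>%VS -> S3_line pl = <[zl]>%VS ->
  c != 0 -> herm zi c = 0 -> herm zj c = 0 ->
  cross_ratio pi pj pk pl = crossr zi zk zl c.
Proof.
move=> ij ei ej ek el c0 ic jc.
have nz (p : S3) (z : cV) : S3_line p = <[z]>%VS -> z != 0.
  move=> e; have [w [w0 _ e']] := S3_lift p; move: w0; rewrite -!memv0 !memvE.
  by rewrite -e' e.
have [zi0 zj0 zk0 zl0] := And4 (nz _ _ ei) (nz _ _ ej) (nz _ _ ek) (nz _ _ el).
have zij : <[zi]>%VS <> <[zj]>%VS.
  by rewrite -ei -ej => /val_inj/eqP; apply/negP.
rewrite /cross_ratio ei ej ek el.
have [ai ai0 ->] := vpick_line zi0; have [aj aj0 ->] := vpick_line zj0.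
have [ak ak0 ->] := vpick_line zk0; have [al al0 ->] := vpick_line zl0.
have [d0 id jd] := polarP (ai *: zi) (aj *: zj).
have [a a0 ->] : exists2 a, a != 0 & polar (ai *: zi) (aj *: zj) = a *: c.
  apply: (polar_unique zi0 zj0 zij) => //.
    by move/eqP: id; rewrite hermZl mulf_eq0 (negbTE ai0) => /eqP.
  by move/eqP: jd; rewrite hermZl mulf_eq0 (negbTE aj0) => /eqP.
exact: crossr_scale.
Qed.

Lemma cross_ratio_act (g : PU21) (pi pj pk pl : S3) : pi != pj ->
  cross_ratio (S3_act g pi) (S3_act g pj) (S3_act g pk) (S3_act g pl)
  = cross_ratio pi pj pk pl.
Proof.
elim/quotW: g => A ij.
have ij' : S3_act (\pi_PU21 A) pi != S3_act (\pi_PU21 A) pj.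
  by rewrite (inj_eq (@S3_act_inj _ _)).
move: ij'; rewrite !S3_act_pi => ij'.
have [zi [_ _ ei]] := S3_lift pi; have [zj [_ _ ej]] := S3_lift pj.
have [zk [_ _ ek]] := S3_lift pk; have [zl [_ _ el]] := S3_lift pl.
have [c [c0 ic jc]] := polar_exists zi zj.
rewrite (cross_ratioE ij ei ej ek el c0 ic jc).
rewrite (cross_ratioE ij' (S3_U21E A ei) (S3_U21E A ej) (S3_U21E A ek)
  (S3_U21E A el) (c := A *m c)) ?U21_mul_eq0 ?herm_U21 //.
by rewrite /crossr !herm_U21.
Qed.

Lemma cross_ratio_F01 (pi pj pk pl : S3) :
  pi != pj -> pi != pk -> pi != pl -> ~ cocircular pi pj pk ->
  ~ cocircular pi pj pl -> ~ cocircular pi pk pl ->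
  is_F01 (cross_ratio pi pj pk pl).
Proof.
move=> ij ik il nijk nijl nikl.
have [zi [zi0 ii ei]] := S3_lift pi; have [zj [zj0 jj ej]] := S3_lift pj.
have [zk [zk0 kk ek]] := S3_lift pk; have [zl [zl0 ll el]] := S3_lift pl.
have [c [c0 ic jc]] := polar_exists zi zj.
rewrite (cross_ratioE ij ei ej ek el c0 ic jc) /crossr.
have ne (p q : S3) (z w : cV) : S3_line p = <[z]>%VS -> S3_line q = <[w]>%VS ->
    p != q -> <[z]>%VS <> <[w]>%VS.
  by move=> e e' /eqP pq; rewrite -e -e' => /val_inj.
have orth (p q : S3) (z w : cV) : z != 0 -> w != 0 -> herm z z = 0 ->
    herm w w = 0 -> S3_line p = <[z]>%VS -> S3_line q = <[w]>%VS ->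
    p != q -> herm z w != 0.
  move=> z0 w0 zz ww e e' /(ne _ _ _ _ e e') h; apply/eqP => zw.
  have [a ea] := null_orth z0 zz ww zw; apply: h; rewrite ea vline_scale //.
  by apply: contraNneq w0 => a0; rewrite ea a0 scale0r.
have ki := orth _ _ _ _ zk0 zi0 kk ii ek ei; rewrite eq_sym in ki.
have li := orth _ _ _ _ zl0 zi0 ll ii el ei; rewrite eq_sym in li.
have ji := orth _ _ _ _ zj0 zi0 jj ii ej ei; rewrite eq_sym in ji.
have pe := herm_perp_two zi0 zj0 (ne _ _ _ _ ei ej ij) c0 ic jc.
have nc (p : S3) (z : cV) : S3_line p = <[z]>%VS -> ~ cocircular pi pj p ->
    herm z c != 0.
  move=> e nijp; apply/eqP => zc; apply: nijp.
  apply/(Ccircle3P _ ij); exists (herm_perp c).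
  by rewrite dim_herm_perp // ei ej e -!memvE !mem_herm_perp ic jc zc !eqxx.
have kc := nc _ _ ek nijk; have lc := nc _ _ el nijl.
rewrite /is_F01 !(mulf_neq0, invr_eq0) ?ki ?li //=.
apply/eqP => h1.
have h : herm zl c * herm zk zi = herm zk c * herm zl zi.
  by rewrite -[LHS](divfK (mulf_neq0 kc (li il))) h1 mul1r.
pose v := herm zk c *: zl + (- herm zl c) *: zk.
have : v \in herm_perp c.
  by rewrite mem_herm_perp hermDl !hermZl mulrC mulNr subrr.
rewrite pe => /memv_addP[_ /vlineP[a ->] [_ /vlineP[b ->] ev]].
have /eqP : herm v zi = 0 by rewrite hermDl !hermZl mulNr h subrr.
rewrite ev hermDl !hermZl ii mulr0 add0r mulf_eq0 (negbTE (ji ij)) orbF.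
move=> /eqP b0; move: ev; rewrite b0 scale0r addr0 => ev.
apply: nikl; apply/(Ccircle3P _ ik); exists (<[zi]> + <[zk]>)%VS.
rewrite dim_two_lines //; last exact: ne ei ek ik.
rewrite ei ek el addvSl addvSr; split=> //; rewrite -memvE.
rewrite -[zl](scalerK kc) memvZ //.
have -> : herm zk c *: zl = a *: zi + herm zl c *: zk.
  by rewrite -ev -addrA -scalerDl addNr scale0r addr0.
by rewrite memv_add ?memvZ ?memv_line.
Qed.

End Geometry.

Section CrossRatioInvariants.
Variable C : numClosedFieldType.
Local Notation S3 := (S3 C).

(* [z_ij] for i != j: (i,j,k,l) is written as (s 0, s 1, s 2, s 3) for the
   unique even permutation s with s 0 = i and s 1 = j; see [zinvE]. *)
Definition zinv (p : 'I_4 -> S3) (i j : 'I_4) : C :=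
  if [pick s : 'S_4 | [&& ~~ odd_perm s, s 0 == i & s 1 == j]] is Some s
  then cross_ratio (p i) (p j) (p (s 2)) (p (s 3)) else 0.

Lemma I4P (i : 'I_4) : [\/ i = 0, i = 1, i = 2 | i = 3].
Proof.
have : [|| i == 0, i == 1, i == 2 | i == 3].
  by case: i => [[|[|[|[|i]]]] hi].
by case/or4P => /eqP ->; [constructor 1|constructor 2|constructor 3|constructor 4].
Qed.

Lemma even_perm4_eq (s t : 'S_4) : ~~ odd_perm s -> ~~ odd_perm t ->
  s 0 = t 0 -> s 1 = t 1 -> s = t.
Proof.
move=> es et e0 e1.
have d01 : forall i : 'I_4, t i != t 0 -> t i != t 1 -> t i = s 2 \/ t i = s 3.
  move=> i; rewrite -[t i](permKV s); set x := (s^-1)%g (t i).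
  rewrite -e0 -e1; case: (I4P x) => -> //; rewrite ?eqxx //; first by left.
  by right.
have inj (i j : 'I_4) : i != j -> t i != t j by rewrite (inj_eq perm_inj).
have [h2|h2] := d01 2 (inj 2 0 isT) (inj 2 1 isT).
  have [h3|h3] := d01 3 (inj 3 0 isT) (inj 3 1 isT).
    by have := inj 3 2 isT; rewrite h2 h3 eqxx.
  by apply/permP => i; case: (I4P i) => ->.
have [h3|h3] := d01 3 (inj 3 0 isT) (inj 3 1 isT); last first.
  by have := inj 3 2 isT; rewrite h2 h3 eqxx.
have e : t = (tperm 2%R 3%R * s)%g.
  apply/permP => i; rewrite permM; case: (I4P i) => ->.
  - by rewrite tpermD.
  - by rewrite tpermD.
  - by rewrite tpermL.
  - by rewrite tpermR.
by move: et; rewrite e odd_permM odd_tperm /= es.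
Qed.

Lemma even_perm4_ex (i j : 'I_4) : i != j ->
  exists s : 'S_4, [/\ ~~ odd_perm s, s 0 = i & s 1 = j].
Proof.
move=> ij; pose t := tperm 0 i; pose s : 'S_4 := (t * tperm (t 1%R) j)%g.
have t0 : t 0 = i := tpermL _ _.
have ti : t 1 != i by rewrite -t0 (inj_eq perm_inj).
have ji : j != i by rewrite eq_sym.
have s0 : s 0 = i by rewrite permM t0 tpermD.
have s1 : s 1 = j by rewrite permM tpermL.
clearbody s; have [os|es] := boolP (odd_perm s); last by exists s.
exists (tperm 2%R 3%R * s)%g; rewrite odd_permM odd_tperm /= os.
split=> //; by rewrite permM tpermD.
Qed.

Lemma zinvE (p : 'I_4 -> S3) (s : 'S_4) : ~~ odd_perm s ->
  zinv p (s 0) (s 1) = cross_ratio (p (s 0)) (p (s 1)) (p (s 2)) (p (s 3)).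
Proof.
move=> es; rewrite /zinv; case: pickP => [t /and3P[et /eqP t0 /eqP t1]|].
  by rewrite (even_perm4_eq et es t0 t1).
by move/(_ s); rewrite es !eqxx.
Qed.

Lemma zinv_act (g : PU21 C) (p : 'I_4 -> S3) (i j : 'I_4) : generic p ->
  i != j -> zinv (fun k => S3_act g (p k)) i j = zinv p i j.
Proof.
case=> p_inj _ /even_perm4_ex[s [es <- <-]]; rewrite !zinvE //.
by rewrite cross_ratio_act // (inj_eq p_inj) (inj_eq perm_inj).
Qed.

Lemma zinv_F01 (p : 'I_4 -> S3) (i j : 'I_4) : generic p -> i != j ->
  is_F01 (zinv p i j).
Proof.
case=> p_inj gp /even_perm4_ex[s [es <- <-]]; rewrite zinvE //.
by apply: cross_ratio_F01; rewrite ?(inj_eq p_inj) ?(inj_eq perm_inj) //;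
  apply: gp; rewrite ?(inj_eq perm_inj).
Qed.

End CrossRatioInvariants.

Section Chains.
Variable C : numClosedFieldType.
Local Notation S3 := (S3 C).
Local Notation PU21 := (PU21 C).

Definition gtuple n : Type :=
  {p : {ffun 'I_n.+1 -> S3} | `[< generic p >]}.
HB.instance Definition _ n := Choice.on (gtuple n).

Lemma gtupleP n (p : gtuple n) : generic (val p).
Proof. exact/asboolP/(valP p). Qed.

Lemma finfun_generic n (f : 'I_n -> S3) :
  generic f -> `[< generic [ffun i => f i] >].
Proof.
move=> gf; apply/asboolP.
by have -> : [ffun i => f i] = f :> ('I_n -> S3) by apply/funext/ffunE.
Qed.

Definition mk_gtuple n (f : 'I_n.+1 -> S3) (gf : generic f) : gtuple n :=
  exist (fun p : {ffun 'I_n.+1 -> S3} => `[< generic p >])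
    [ffun i => f i] (finfun_generic gf).

Definition gtuple_act n (g : PU21) (p : gtuple n) : gtuple n :=
  mk_gtuple (generic_act g (gtupleP p)).

(* (p_0, ..., p_n+1) with p_i omitted. *)
Definition face n (i : 'I_n.+2) (p : gtuple n.+1) : gtuple n :=
  mk_gtuple (generic_comp (@lift_inj _ i) (gtupleP p)).

Definition chain n : Type := {freeg (gtuple n)}.
HB.instance Definition _ n := GRing.Zmodule.on (chain n).

Definition chain_act n (g : PU21) : chain n -> chain n :=
  fgext (fun p => << gtuple_act g p >> : chain n).
HB.instance Definition _ n g := GRing.Additive.on (@chain_act n g).

(* Index shift: [bd n] is the differential d_{n+1}. *)
Definition bd n : chain n.+1 -> chain n :=
  fgext (fun p => \sum_(i < n.+2) (<< (-1) ^+ i *g face i p >> : chain n)).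
HB.instance Definition _ n := GRing.Additive.on (@bd n).

Definition chainG n : Type := coinvariants (@chain_act n).
HB.instance Definition _ n := ZmodQuotient.on (chainG n).

Lemma face_act n (i : 'I_n.+2) g (p : gtuple n.+1) :
  face i (gtuple_act g p) = gtuple_act g (face i p).
Proof. by apply/val_inj/ffunP => k; rewrite !ffunE /= !ffunE. Qed.

Lemma bd_act n g (x : chain n.+1) : bd (chain_act g x) = chain_act g (bd x).
Proof.
pose f : {additive chain n.+1 -> chain n} := @bd n \o @chain_act n.+1 g.
pose h : {additive chain n.+1 -> chain n} := @chain_act n g \o @bd n.
apply: (@additive_freeg_ext _ _ f h) => p /=.
rewrite /chain_act /bd !fgextU raddf_sum /=; apply: eq_bigr => i _.
by rewrite fgextUz face_act freegU_mulz intz.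
Qed.

Definition pi_bd n : {additive chain n.+1 -> chainG n} := \pi_(chainG n) \o @bd n.

Lemma pi_bd_coinv n x : coinv_rel (@chain_act n.+1) x -> pi_bd n x = 0.
Proof.
case=> g [m ->]; rewrite raddfB /= bd_act; apply/eqP; rewrite subr_eq0.
by apply/eqP/abquot_eq/mem_subgroup_gen; exists g, (bd m).
Qed.

Definition dbar n : chainG n.+1 -> chainG n := abquot_map (pi_bd n).
HB.instance Definition _ n := GRing.isZmodMorphism.Build _ _ (@dbar n)
  (abquot_map_zmod_morphism (@pi_bd_coinv n)).

Lemma dbarE n (x : chain n.+1) :
  dbar (\pi_(chainG n.+1) x) = \pi_(chainG n) (bd x).
Proof. exact: (abquot_mapE (@pi_bd_coinv n)). Qed.

Definition beta0 (p : 'I_4 -> S3) : preBloch C :=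
  bsymb (zinv p 0 1) + bsymb (zinv p 1 0)
  + bsymb (zinv p 2 3) + bsymb (zinv p 3 2).

Definition beta : chain 3 -> preBloch C :=
  fgext (fun p : gtuple 3 => beta0 (val p)).
HB.instance Definition _ := GRing.Additive.on beta.

Lemma beta_coinv x : coinv_rel (@chain_act 3) x -> beta x = 0.
Proof.
case=> g [m ->]; rewrite raddfB /=; apply/eqP; rewrite subr_eq0; apply/eqP.
apply: (@additive_freeg_ext _ _ (beta \o @chain_act 3 g : {additive _ -> _})
  beta) => p /=.
rewrite /chain_act /beta !fgextU /beta0.
have -> : val (gtuple_act g p) = (fun k => S3_act g (val p k)) :> ('I_4 -> S3).
  by apply/funext/ffunE.
by rewrite !(zinv_act g (gtupleP p)).
Qed.

Definition betabar : chainG 3 -> preBloch C := abquot_map beta.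
HB.instance Definition _ := GRing.isZmodMorphism.Build _ _ betabar
  (abquot_map_zmod_morphism beta_coinv).

Lemma betabarE (p : gtuple 3) :
  betabar (\pi_(chainG 3) << p >>) = beta0 (val p).
Proof. by rewrite [LHS](abquot_mapE beta_coinv) [LHS]fgextU. Qed.

Definition chainG_coker n : Type := abquot (range (@dbar n)).
HB.instance Definition _ n := ZmodQuotient.on (chainG_coker n).

End Chains.

(* Main.v *)
Require Import Defs.
From HB Require Import structures.
From mathcomp Require Import all_boot all_order all_algebra perm.
From mathcomp Require Import boolp classical_sets reals.
From mathcomp Require Import ring.
From mathcomp Require Import complex freeg.

Set Implicit Arguments.
Unset Strict Implicit.
Unset Printing Implicit Defensive.

Import Order.TTheory GRing.Theory Num.Theory.

Local Open Scope ring_scope.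
Local Open Scope quotient_scope.
Local Open Scope classical_set_scope.

(* For a null vector z, the lines through z in CP^2 form a projective line.
   On it z_ij is the cross-ratio of the tangent line z^perp and of the lines
   joining z = p_i to the three other points.  Since [1/x] = [1-x] = -[x] in
   P(C), the symbol of a cross-ratio is alternating, so that
   beta(p_0,...,p_3) = sum_i (-1)^i T(p_i; others in increasing order).
   In the boundary of a 5-tuple, the four terms based at p_i are, by the
   five-term relation in the pencil of p_i, equal up to sign to the symbol of
   the cross-ratio of the four other points seen from p_i.  The alternating sum
   of these five symbols is again a five-term relation, because five points of
   CP^2 have a Gale dual on CP^1 with the same cross-ratios. *)

(** * Inversion and complement of symbols in the pre-Bloch group *)

Section BlochRelations.
Variable C : numClosedFieldType.
Implicit Types x y u v : C.

Lemma bsymb_five_term x y : is_F01 x -> is_F01 y -> x != y ->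
  bsymb x - bsymb y + bsymb (y / x)
  - bsymb ((1 - x^-1) / (1 - y^-1)) + bsymb ((1 - x) / (1 - y)) = 0.
Proof.
move=> hx hy xy; rewrite /bsymb -!raddfB -!raddfD -raddfB -raddfD.
have <- : \pi_(preBloch C) 0 = 0 by rewrite raddf0.
apply/abquot_eq; rewrite subr0; apply: mem_subgroup_gen.
by exists (MkF01 hx), (MkF01 hy); rewrite -val_eqE.
Qed.

Lemma F01V x : is_F01 x -> is_F01 x^-1.
Proof. by rewrite /is_F01 invr_eq0 invr_eq1. Qed.

Lemma F01B x : is_F01 x -> is_F01 (1 - x).
Proof.
case/andP=> x0 x1; rewrite /is_F01 subr_eq0 eq_sym x1 /=.
by rewrite subr_eq addrC -subr_eq subrr eq_sym.
Qed.

Let pairV x : preBloch C := bsymb x + bsymb x^-1.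

(** Add the five-term relations for (x, y) and (y, x): [x] - [y] cancels, and each of the other
    three arguments meets its inverse. *)
Lemma bsymb_pairVM u v : is_F01 u -> is_F01 v -> u * v != 1 ->
  pairV (u * v) = pairV u + pairV v.
Proof.
case/andP=> u0 u1 /andP[v0 v1] uv1.
have d0 : u * v - 1 != 0 by rewrite subr_eq0.
have u10 : u - 1 != 0 by rewrite subr_eq0.
have v10 : v - 1 != 0 by rewrite subr_eq0.
(* Solution of y / x = v and (1 - x) / (1 - y) = u; the remaining argument is then u v. *)
pose x := (u - 1) / (u * v - 1); pose y := v * x.
have x0 : x != 0 by rewrite mulf_neq0 ?invr_eq0.
have y0 : y != 0 by rewrite mulf_neq0.
have xB : 1 - x = u * (v - 1) / (u * v - 1) by rewrite /x; field.
have yB : 1 - y = (v - 1) / (u * v - 1) by rewrite /y /x; field.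
have xB0 : 1 - x != 0 by rewrite xB !mulf_neq0 ?invr_eq0.
have yB0 : 1 - y != 0 by rewrite yB !mulf_neq0 ?invr_eq0.
have Fx : is_F01 x by rewrite /is_F01 x0 eq_sym -subr_eq0 xB0.
have Fy : is_F01 y by rewrite /is_F01 y0 eq_sym -subr_eq0 yB0.
have xy : x != y.
  rewrite -subr_eq0 /y -{1}[x]mul1r -mulrBl mulf_neq0 //.
  by rewrite -opprB oppr_eq0.
have yx : y / x = v by rewrite mulfK.
have eu : (1 - x) / (1 - y) = u by rewrite xB yB; field; rewrite d0 v10.
have euv : (1 - x^-1) / (1 - y^-1) = u * v.
  rewrite -[in RHS]eu -[in RHS]yx.
  field; rewrite ?x0 ?y0 ?yB0 //=.
  by rewrite -oppr_eq0 opprB.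
have := bsymb_five_term Fx Fy xy.
have := bsymb_five_term Fy Fx; rewrite eq_sym => /(_ xy).
rewrite -[x / y]invf_div -[(1 - y^-1) / _]invf_div -[(1 - y) / _]invf_div.
rewrite yx eu euv /pairV => e1 e2.
have e : (bsymb v + bsymb v^-1) + (bsymb u + bsymb u^-1)
   - (bsymb (u * v) + bsymb (u * v)^-1) = 0.
  rewrite -[RHS](addr0 0) -{1}e1 -e2 !opprD ?opprK.
  rewrite !addrA [RHS](ACl ((8*3)*(10*5)*(9*4)*((1*7)*(2*6))))/=.
  by rewrite subrr addNr !addr0 !addrA.
by apply/esym/eqP; rewrite -subr_eq0 -e [pairV u + _]addrC.
Qed.

(* Multiplicativity of [pairV] at [w = w ^+ 2 * w^-1], with [pairV w^-1 = pairV w],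
   kills [pairV] on squares, that is, everywhere. *)
Lemma bsymbV x : is_F01 x -> bsymb x^-1 = - bsymb x.
Proof.
case/andP=> x0 x1; pose w := sqrtC x.
have ww : w * w = x by rewrite -expr2 sqrtCK.
have Fw : is_F01 w.
  rewrite /is_F01 sqrtC_eq0 x0 /=; apply: contraNneq x1 => w1.
  by rewrite -ww w1 mulr1.
have w0 : w != 0 by case/andP: Fw.
have w1 : w != 1 by case/andP: Fw.
have Fx : is_F01 (w * w) by rewrite ww /is_F01 x0.
have := @bsymb_pairVM (w * w) w^-1 Fx (F01V Fw).
rewrite mulfK // => /(_ w1); rewrite /pairV invrK ww [bsymb w^-1 + _]addrC.
rewrite -{1}[bsymb w + _]add0r => /addIr/esym/eqP.
by rewrite addrC addr_eq0 => /eqP.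
Qed.

(** The relations for (x, y) and (1 - y, 1 - x) share their last three terms: y / x and (1 - x) / (1
    - y) trade places. Subtract. *)
Lemma bsymbB_const x y : is_F01 x -> is_F01 y -> x != y ->
  bsymb x + bsymb (1 - x) = bsymb y + bsymb (1 - y).
Proof.
move=> Fx Fy xy; have e1 := bsymb_five_term Fx Fy xy.
have := @bsymb_five_term (1 - y) (1 - x) (F01B Fy) (F01B Fx).
rewrite (inj_eq (addrI 1)) eqr_opp eq_sym => /(_ xy).
have [/andP[x0 x1] /andP[y0 y1]] := conj Fx Fy.
have xB0 : 1 - x != 0 by rewrite subr_eq0 eq_sym.
have yB0 : 1 - y != 0 by rewrite subr_eq0 eq_sym.
have yB0' : y - 1 != 0 by rewrite subr_eq0.
rewrite !subKr.
have -> : (1 - (1 - y)^-1) / (1 - (1 - x)^-1) = (1 - x^-1) / (1 - y^-1).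
  field; rewrite ?x0 ?y0 ?xB0 ?yB0 ?yB0' //=.
  by rewrite addrAC subrr add0r oppr_eq0 x0.
move=> e2; apply/eqP; rewrite -subr_eq0 opprD; apply/eqP.
rewrite -[RHS](subrr 0) -{1}e1 -e2 !opprD !opprK.
rewrite !addrA [RHS](ACl ((1*7)*(2*6)*(3*10)*(4*9)*(5*8)))/=.
by rewrite !subrr addNr !addr0 !addrA.
Qed.

(* The constant of [bsymbB_const] vanishes: at the primitive sixth root of unity
   [w] one has [1 - w = w^-1]. *)
Lemma bsymbB x : is_F01 x -> bsymb (1 - x) = - bsymb x.
Proof.
pose s := sqrtC (- 3 : C); pose w := (1 + s) / 2.
have ss : s ^+ 2 = - 3 by rewrite sqrtCK.
have w1 : w * (1 - w) = 1.
  transitivity ((1 - s ^+ 2) / 4); first by rewrite /w; field.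
  by rewrite ss; field.
have wV : 1 - w = w^-1.
  have w0 : w != 0.
    by apply: contra_eqN w1 => /eqP ->; rewrite mul0r eq_sym oner_eq0.
  by apply: (mulfI w0); rewrite w1 mulfV.
have Fw : is_F01 w.
  rewrite /is_F01 -negb_or; apply: contra_eqN w1 => /orP[]/eqP->.
    by rewrite mul0r eq_sym oner_eq0.
  by rewrite subrr mulr0 eq_sym oner_eq0.
have fw : bsymb w + bsymb (1 - w) = 0 by rewrite wV bsymbV // subrr.
move=> Fx; apply/eqP; rewrite -addr_eq0 addrC; apply/eqP.
by have [->//|xw] := eqVneq x w; rewrite (bsymbB_const Fx Fw xw).
Qed.

End BlochRelations.

(** * Five points on a projective line *)

Section FiveBrackets.
Variable C : numClosedFieldType.

(* The symbol of the cross-ratio of a, b, c, d on a projective line, as a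
   function of the brackets of these points. *)
Definition xsymb (ac bd ad bc : C) : preBloch C :=
  bsymb (ac * bd / (ad * bc)).

(* [bij] stands for the bracket of the points i and j on a projective line. *)
Lemma five_brackets (b01 b02 b03 b04 b12 b13 b14 b23 b24 b34 : C) :
  all (fun b => b != 0) [:: b01; b02; b03; b04; b12; b13; b14; b23; b24; b34] ->
  b01 * b23 - b02 * b13 + b03 * b12 = 0 ->
  b01 * b24 - b02 * b14 + b04 * b12 = 0 ->
  b01 * b34 - b03 * b14 + b04 * b13 = 0 ->
  xsymb b02 b13 b03 b12 - xsymb b02 b14 b04 b12 + xsymb b03 b14 b04 b13
  - xsymb b03 b24 b04 b23 + xsymb b13 b24 b14 b23 = 0.
Proof.
case/and5P=> n01 n02 n03 n04 /and5P[n12 n13 n14 n23 /and3P[n24 n34 _]].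
move=> P4 P3 P2.
(* The five-term relation is applied to these cross-ratios of 0, 1, 2, 3 and 0, 1, 2, 4. The Plücker
   relations, named after the omitted point, factor 1 - x, 1 - y and x - y into brackets. *)
rewrite /xsymb; set x := b02 * b13 / _; set y := b02 * b14 / _.
have x0 : x != 0 by rewrite !(mulf_neq0, invr_neq0).
have y0 : y != 0 by rewrite !(mulf_neq0, invr_neq0).
have xB : 1 - x = - (b01 * b23) / (b03 * b12).
  transitivity ((b03 * b12 - b02 * b13) / (b03 * b12)).
    by rewrite /x; field; rewrite n03 n12.
  by congr (_ / _); apply/eqP; rewrite -subr_eq0 opprK -P4; apply/eqP; ring.
have yB : 1 - y = - (b01 * b24) / (b04 * b12).
  transitivity ((b04 * b12 - b02 * b14) / (b04 * b12)).
    by rewrite /y; field; rewrite n04 n12.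
  by congr (_ / _); apply/eqP; rewrite -subr_eq0 opprK -P3; apply/eqP; ring.
have xy : x != y.
  rewrite -subr_eq0; have -> : x - y = - b02 * (b01 * b34) / (b03 * b04 * b12).
    transitivity (- b02 * (b03 * b14 - b04 * b13) / (b03 * b04 * b12)).
      by rewrite /x /y; field; rewrite n03 n04 n12.
    congr (_ * _ / _); apply/eqP; rewrite eq_sym -subr_eq0 -P2.
    by apply/eqP; ring.
  by rewrite !(mulf_neq0, invr_neq0, oppr_eq0).
have xB0 : 1 - x != 0 by rewrite xB !(mulf_neq0, invr_neq0, oppr_eq0).
have yB0 : 1 - y != 0 by rewrite yB !(mulf_neq0, invr_neq0, oppr_eq0).
have Fx : is_F01 x by rewrite /is_F01 x0 eq_sym -subr_eq0.
have Fy : is_F01 y by rewrite /is_F01 y0 eq_sym -subr_eq0.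
have [F1 F2 F3] := five_term_F01 Fx Fy xy.
have e1 : b03 * b14 / (b04 * b13) = y / x.
  by rewrite /x /y; field; rewrite n02 n03 n04 n12 n13.
(* The last two arguments appear inverted; [bsymbV] turns this into the signs of the statement. *)
have e3 : b03 * b24 / (b04 * b23) = ((1 - x) / (1 - y))^-1.
  by rewrite xB yB; field; rewrite n01 n03 n04 n12 n23 n24.
have e2 : b13 * b24 / (b14 * b23) = ((1 - x^-1) / (1 - y^-1))^-1.
  have -> : (1 - x^-1) / (1 - y^-1) = (1 - x) / (1 - y) * (y / x).
    by field; rewrite x0 y0 yB0 /= -oppr_eq0 opprB.
  by rewrite -e1 xB yB; field; rewrite n01 n03 n04 n12 n23 n24 n13 n14.
rewrite e1 e2 e3 !bsymbV // opprK -(bsymb_five_term Fx Fy xy).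
by rewrite [LHS]addrAC.
Qed.

End FiveBrackets.

(** * Brackets of null vectors, tangent lines and pencils *)

Section Brackets.
Variable C : numClosedFieldType.
Local Notation cV := 'cV[C]_3.
Local Notation S3 := (S3 C).
Implicit Types (z w a b c d : cV) (p q r : S3).

Definition det3 z w a : C :=
  z 0 0 * (w 1 0 * a 2 0 - w 2 0 * a 1 0)
  - z 1 0 * (w 0 0 * a 2 0 - w 2 0 * a 0 0)
  + z 2 0 * (w 0 0 * a 1 0 - w 1 0 * a 0 0).

(** The conjugate of the usual cross product, with entries reversed to undo [J21]. When nonzero, it
    can serve as the polar vector c_ij. *)
Definition hcross z w : cV := \col_(i < 3)
  (if i == 0 then z 0 0 * w 1 0 - z 1 0 * w 0 0
   else if i == 1 then z 2 0 * w 0 0 - z 0 0 * w 2 0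
   else z 1 0 * w 2 0 - z 2 0 * w 1 0)^*.

Lemma herm_hcross z w a : herm a (hcross z w) = det3 z w a.
Proof. by rewrite hermE !mxE /= !conjCK /det3; ring. Qed.

Lemma det3_rot z w a : det3 z w a = det3 w a z.
Proof. by rewrite /det3; ring. Qed.

Lemma det3_swap z w a : det3 z a w = - det3 z w a.
Proof. by rewrite /det3; ring. Qed.

(** Cramer's rule writes [det3 a b c *: z] as a combination of a, b, c; pair it with z. This is the
    Plücker relation of the tangent line and three lines through z. *)
Lemma herm_plucker z a b c : herm z z = 0 ->
  herm a z * det3 z b c - herm b z * det3 z a c + herm c z * det3 z a b = 0.
Proof.
move=> zz; transitivity (herm z z * det3 a b c); last by rewrite zz mul0r.
by rewrite !hermE /det3; ring.
Qed.

(** The entries of [herm z w *: w - herm w w *: z] are combinations of those of the cross product,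
    and [herm w w] vanishes. *)
Lemma hcross_neq0 z w : w != 0 -> herm w w = 0 -> herm z w != 0 ->
  hcross z w != 0.
Proof.
move=> w0 ww zw; apply: contra w0 => /eqP c0.
have e i : (hcross z w i 0)^* = 0 by rewrite c0 mxE conjC0.
have := e 0; have := e 1; have := e 2; rewrite !mxE /= !conjCK.
move=> e12 e20 e01.
have : herm z w *: w = 0.
  transitivity (herm w w *: z); last by rewrite ww scale0r.
  have comb (u v x y : C) : x = 0 -> y = 0 -> u * x - v * y = 0.
    by move=> -> ->; rewrite !mulr0 subr0.
  apply: cV3P; rewrite !hermE !mxE -[RHS]addr0.
  - by rewrite -(comb (w 0 0)^* (w 1 0)^* _ _ e20 e01); ring.
  - by rewrite -(comb (w 2 0)^* (w 0 0)^* _ _ e01 e12); ring.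
  - by rewrite -(comb (w 1 0)^* (w 2 0)^* _ _ e12 e20); ring.
by move/eqP; rewrite scaler_eq0 (negbTE zw).
Qed.

Lemma S3_lift_null p z : S3_line p = <[z]>%VS -> z != 0 /\ herm z z = 0.
Proof.
have [w [w0 ww ->]] := S3_lift p => e; split.
  by move: w0; rewrite -!memv0 !memvE e.
have /vlineP[a ->] : z \in <[w]>%VS by rewrite e memv_line.
by rewrite hermZl hermZr ww !mulr0.
Qed.

Lemma herm_lift_neq0 p q z w : p != q ->
  S3_line p = <[z]>%VS -> S3_line q = <[w]>%VS -> herm z w != 0.
Proof.
move=> pq ep eq; have [z0 zz] := S3_lift_null ep.
have [w0 ww] := S3_lift_null eq.
apply: contraNneq pq => /(null_orth z0 zz ww)[a ea].
apply/eqP/val_inj; rewrite /= ep eq ea vline_scale //.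
by apply: contraNneq w0 => a0; rewrite ea a0 scale0r.
Qed.

Lemma hcross_lift_neq0 p q z w : p != q ->
  S3_line p = <[z]>%VS -> S3_line q = <[w]>%VS -> hcross z w != 0.
Proof.
move=> pq ep eq; have [w0 ww] := S3_lift_null eq.
by apply: hcross_neq0 => //; apply: herm_lift_neq0 ep eq.
Qed.

(** Otherwise all three points lie on the projective line polar to [hcross z w], hence on a
    C-circle. *)
Lemma det3_lift_neq0 p q r z w a : p != q -> ~ cocircular p q r ->
  S3_line p = <[z]>%VS -> S3_line q = <[w]>%VS -> S3_line r = <[a]>%VS ->
  det3 z w a != 0.
Proof.
move=> pq npqr ep eq er; apply/eqP => d0; apply: npqr.
apply/(Ccircle3P _ pq); exists (herm_perp (hcross z w)).
rewrite dim_herm_perp ?(hcross_lift_neq0 pq ep eq) // ep eq er -!memvE.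
by rewrite !mem_herm_perp !herm_hcross d0 /det3; split=> //; apply/eqP; ring.
Qed.

Lemma cross_ratio_det p q r s z w a b : p != q ->
  S3_line p = <[z]>%VS -> S3_line q = <[w]>%VS ->
  S3_line r = <[a]>%VS -> S3_line s = <[b]>%VS ->
  cross_ratio p q r s = (herm a z * det3 z w b) / (herm b z * det3 z w a).
Proof.
move=> pq ep eq er es.
rewrite (cross_ratioE pq ep eq er es (hcross_lift_neq0 pq ep eq)).
- by rewrite /crossr !herm_hcross; congr (_ / _); exact: mulrC.
- by rewrite herm_hcross /det3; ring.
- by rewrite herm_hcross /det3; ring.
Qed.

(* In the pencil of lines through a null vector z, the bracket of the tangent
   line z^perp with the line through a is [herm a z]. *)
Definition tangent_symb z a b c : preBloch C :=
  xsymb (herm b z) (det3 z a c) (herm c z) (det3 z a b).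

Definition tangent_sum a b c d : preBloch C :=
  tangent_symb a b c d - tangent_symb b a c d
  + tangent_symb c a b d - tangent_symb d a b c.

Definition pencil_symb z a b c d : preBloch C :=
  xsymb (det3 z a c) (det3 z b d) (det3 z a d) (det3 z b c).


(** This is [herm_plucker] divided by [herm b z * det3 z a c]. *)
Lemma tangent_compl z a b c : herm z z = 0 -> herm b z != 0 ->
  det3 z a c != 0 ->
  1 - (herm a z * det3 z c b) / (herm b z * det3 z c a)
  = (herm c z * det3 z a b) / (herm b z * det3 z a c).
Proof.
move=> zz hb dac; rewrite (det3_swap z b c) (det3_swap z a c).
transitivity ((herm b z * det3 z a c - herm a z * det3 z b c) /
              (herm b z * det3 z a c)).
  by field; rewrite hb dac.
congr (_ / _); apply/eqP; rewrite -subr_eq0 -oppr_eq0 -(herm_plucker a b c zz).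
by apply/eqP; ring.
Qed.

(** z_01 has the required form already. The arguments of the other tangent symbols are 1/x for x =
    z_10, 1/(1-x) for x = z_23 and x/(x-1) for x = z_32; the number of inversions and complements
    gives the sign. *)
Lemma beta0_tangent (q : 'I_4 -> S3) (w : 'I_4 -> cV) : generic q ->
  (forall i, S3_line (q i) = <[w i]>%VS) ->
  beta0 q = tangent_sum (w 0) (w 1) (w 2) (w 3).
Proof.
move=> gq qw; have [q_inj ngq] := gq.
have ne i j : i != j -> q i != q j by rewrite (inj_eq q_inj).
have hn i j : i != j -> herm (w i) (w j) != 0.
  by move=> ij; apply: herm_lift_neq0 (ne i j ij) (qw i) (qw j).
have dn i j k : i != j -> i != k -> j != k -> det3 (w i) (w j) (w k) != 0.
  move=> ij ik jk.
  exact: det3_lift_neq0 (ne i j ij) (ngq i j k ij ik jk) (qw i) (qw j) (qw k).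
have ww i : herm (w i) (w i) = 0 by have [] := S3_lift_null (qw i).
have crE i j k l : i != j -> cross_ratio (q i) (q j) (q k) (q l) =
    (herm (w k) (w i) * det3 (w i) (w j) (w l)) /
    (herm (w l) (w i) * det3 (w i) (w j) (w k)).
  by move=> ij; apply: cross_ratio_det (ne i j ij) _ _ _ _.
have z01 : zinv q 0 1 = cross_ratio (q 0) (q 1) (q 2) (q 3).
  by have := @zinvE _ q 1%g; rewrite odd_perm1 !perm1 => /(_ isT).
have zperm (s : 'S_4) i j k l : ~~ odd_perm s ->
    s 0 = i -> s 1 = j -> s 2 = k -> s 3 = l ->
    zinv q i j = cross_ratio (q i) (q j) (q k) (q l).
  by move=> es <- <- <- <-; apply: zinvE.
have z10 : zinv q 1 0 = cross_ratio (q 1) (q 0) (q 3) (q 2).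
  by apply: (zperm (tperm 0%R 1%R * tperm 2%R 3%R)%g);
    rewrite ?odd_permM ?odd_tperm ?permM ?permE /=.
have z23 : zinv q 2 3 = cross_ratio (q 2) (q 3) (q 0) (q 1).
  by apply: (zperm (tperm 0%R 2%R * tperm 1%R 3%R)%g);
    rewrite ?odd_permM ?odd_tperm ?permM ?permE /=.
have z32 : zinv q 3 2 = cross_ratio (q 3) (q 2) (q 1) (q 0).
  by apply: (zperm (tperm 0%R 3%R * tperm 1%R 2%R)%g);
    rewrite ?odd_permM ?odd_tperm ?permM ?permE /=.
have F i j : i != j -> is_F01 (zinv q i j) by apply: zinv_F01.
have e1 : bsymb (zinv q 1 0) = - tangent_symb (w 1) (w 0) (w 2) (w 3).
  rewrite -[zinv q 1 0]invrK bsymbV ?F01V ?F //; congr (- bsymb _).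
  by rewrite z10 crE // invf_div.
have e2 : bsymb (zinv q 2 3) = tangent_symb (w 2) (w 0) (w 1) (w 3).
  rewrite -[LHS]opprK -bsymbB ?F // -bsymbV ?F01B ?F //; congr bsymb.
  by rewrite z23 crE // tangent_compl ?hn ?dn // invf_div.
have e3 : bsymb (zinv q 3 2) = - tangent_symb (w 3) (w 0) (w 1) (w 2).
  rewrite -[LHS]opprK -bsymbV ?F // -[bsymb _^-1]opprK -bsymbB ?F01V ?F //.
  rewrite -bsymbV ?F01B ?F01V ?F //; congr (- bsymb _).
  by rewrite z32 crE // invf_div tangent_compl ?hn ?dn // invf_div.
by rewrite /beta0 e1 e2 e3 z01 crE.
Qed.

(** Apply [five_brackets] in the pencil at z, with the tangent line as point 0 and the lines through
    a, b, c, d as points 1 to 4. The Plücker relations it asks for all involve point 0, so they are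
    [herm_plucker]. *)
Lemma tangent_five z a b c d : herm z z = 0 ->
  all (fun x => herm x z != 0) [:: a; b; c; d] ->
  all (fun x => x != 0) [:: det3 z a b; det3 z a c; det3 z a d;
                            det3 z b c; det3 z b d; det3 z c d] ->
  tangent_symb z b c d - tangent_symb z a c d + tangent_symb z a b d
  - tangent_symb z a b c = pencil_symb z a b c d.
Proof.
move=> zz /= /and5P[na nb nc nd _] /and5P[nab nac nad nbc /and3P[nbd ncd _]].
have := @five_brackets _ (herm a z) (herm b z) (herm c z) (herm d z)
  (det3 z a b) (det3 z a c) (det3 z a d) (det3 z b c) (det3 z b d) (det3 z c d).
rewrite /= na nb nc nd nab nac nad nbc nbd ncd.
move/(_ isT (herm_plucker _ _ _ zz) (herm_plucker _ _ _ zz)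
  (herm_plucker _ _ _ zz)).
rewrite -/(tangent_symb z a b c) -/(tangent_symb z a b d)
  -/(tangent_symb z a c d) -/(tangent_symb z b c d) -/(pencil_symb z a b c d).
move/eqP; rewrite addrC addr_eq0 => /eqP->; rewrite !opprD !opprK.
by rewrite [LHS](ACl (4*3*2*1)).
Qed.

(* Gale duality: the minors of five points of the plane, indexed by the
   complementary pairs, satisfy the Plücker relations of five points of a
   line; the cross-ratios agree. *)
Lemma pencil_five a b c d e :
  all (fun x => x != 0) [:: det3 a b c; det3 a b d; det3 a b e;
    det3 a c d; det3 a c e; det3 a d e; det3 b c d; det3 b c e; det3 b d e;
    det3 c d e] ->
  pencil_symb a b c d e - pencil_symb b a c d e + pencil_symb c a b d e
  - pencil_symb d a b c e + pencil_symb e a b c d = 0.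
Proof.
case/and5P=> abc abd abe acd /and5P[ace ade bcd bce /and3P[bde cde _]].
have := @five_brackets _ (det3 c d e) (det3 b d e) (det3 b c e) (det3 b c d)
  (det3 a d e) (det3 a c e) (det3 a c d) (det3 a b e) (det3 a b d) (det3 a b c).
rewrite /= abc abd abe acd ace ade bcd bce bde cde => /(_ isT).
(* Reordering rows may change the sign of both products; the quotient stays the same. *)
have sgn (k l m n k' l' m' n' : C) : k * l = - (k' * l') ->
    m * n = - (m' * n') -> xsymb k l m n = xsymb k' l' m' n'.
  by rewrite /xsymb => -> ->; rewrite invrN mulrNN.
have -> : xsymb (det3 b d e) (det3 a c e) (det3 b c e) (det3 a d e)
          = pencil_symb e a b c d.
  by congr (bsymb (_ / _)); rewrite /det3; ring.
have -> : xsymb (det3 b d e) (det3 a c d) (det3 b c d) (det3 a d e)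
          = pencil_symb d a b c e.
  by apply: sgn; rewrite /det3; ring.
have -> : xsymb (det3 b c e) (det3 a c d) (det3 b c d) (det3 a c e)
          = pencil_symb c a b d e.
  by congr (bsymb (_ / _)); rewrite /det3; ring.
have -> : xsymb (det3 b c e) (det3 a b d) (det3 b c d) (det3 a b e)
          = pencil_symb b a c d e.
  by apply: sgn; rewrite /det3; ring.
have -> : xsymb (det3 a c e) (det3 a b d) (det3 a c d) (det3 a b e)
          = pencil_symb a b c d e.
  by congr (bsymb (_ / _)); rewrite /det3; ring.
(* The Plücker relation of four points of the dual line is that of the same four points in the
   pencil of the fifth. *)
have pl (k l m n p : cV) : det3 m n p * det3 k l p - det3 l n p * det3 k m p
    + det3 l m p * det3 k n p = 0.
  by rewrite /det3; ring.
move=> h; rewrite -[RHS]h.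
- by rewrite [LHS](ACl (5*4*3*2*1)).
- by rewrite -[RHS](pl a b c d e); ring.
- by rewrite -[RHS]oppr0 -[X in _ = - X](pl a b c e d) /det3; ring.
- by rewrite -[RHS](pl a b d e c) /det3; ring.
Qed.

(** Expanding [pencil_five] by [tangent_five] produces the same twenty tangent symbols, all with the
    opposite sign. *)
Lemma tangent_sum_five a b c d e :
  all (fun x => herm x x == 0) [:: a; b; c; d; e] ->
  pairwise (fun x y => (herm x y != 0) && (herm y x != 0)) [:: a; b; c; d; e] ->
  all (fun x => x != 0) [:: det3 a b c; det3 a b d; det3 a b e;
    det3 a c d; det3 a c e; det3 a d e; det3 b c d; det3 b c e; det3 b d e;
    det3 c d e] ->
  tangent_sum b c d e - tangent_sum a c d e + tangent_sum a b d e
  - tangent_sum a b c e + tangent_sum a b c d = 0.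
Proof.
move=> /= /and5P[/eqP aa /eqP bb /eqP cc /eqP dd /andP[/eqP ee _]] hn dn.
have := pencil_five dn; move: hn dn => /=; rewrite !andbT.
case/and4P=> /and4P[/andP[ab ba] /andP[ac ca] /andP[ad da] /andP[ae ea]].
case/and3P=> /andP[bc cb] /andP[bd db] /andP[be eb].
case/andP=> /andP[cd dc] /andP[ce ec] /andP[de ed].
case/and5P=> abc abd abe acd /and5P[ace ade bcd bce /andP[bde cde]].
have sw x y z : det3 x y z != 0 -> det3 y x z != 0.
  by rewrite [det3 y x z]det3_rot det3_swap oppr_eq0.
have rot x y z : det3 x y z != 0 -> det3 z x y != 0.
  by rewrite [det3 z x y]det3_rot.
rewrite -!tangent_five //=; try by do !(apply/andP; split; auto).
move/(congr1 -%R); rewrite oppr0 /tangent_sum => <-.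
rewrite !opprD !opprK !addrA.
by rewrite [LHS](ACl (5*9*13*17*1*10*14*18*2*6*15*19*3*7*11*20*4*8*12*16)).
Qed.

End Brackets.

(** * Vanishing on boundaries and descent to the quotient *)

Lemma beta_bd (C : numClosedFieldType) (x : chain C 4) : beta (bd x) = 0.
Proof.
pose f : {additive chain C 4 -> preBloch C} := @beta C \o @bd C 3.
pose g : {additive chain C 4 -> preBloch C} := \0.
apply: (@additive_freeg_ext _ _ f g) => p /=.
pose q := val p.
have gp := gtupleP p; have [q_inj ngq] := gp.
(* One lift per vertex serves all five faces, so that their brackets are the same numbers. *)
have /choice[v qv] : forall i, exists z : 'cV[C]_3, S3_line (q i) = <[z]>%VS.
  by move=> i; have [z [_ _ e]] := S3_lift (q i); exists z.
have ne i j : i != j -> q i != q j by rewrite (inj_eq q_inj).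
have vv i : herm (v i) (v i) == 0 by have [_ ->] := S3_lift_null (qv i).
have hn i j : i != j -> (herm (v i) (v j) != 0) && (herm (v j) (v i) != 0).
  move=> ij; rewrite (herm_lift_neq0 (ne i j ij) (qv i) (qv j)).
  by rewrite eq_sym in ij; rewrite (herm_lift_neq0 (ne j i ij) (qv j) (qv i)).
have dn i j k : i != j -> i != k -> j != k -> det3 (v i) (v j) (v k) != 0.
  move=> ij ik jk.
  exact: det3_lift_neq0 (ne i j ij) (ngq i j k ij ik jk) (qv i) (qv j) (qv k).
have faceE (i : 'I_5) o j k l m : odd i = o -> fintype.lift i 0 = j ->
    fintype.lift i 1 = k -> fintype.lift i 2 = l -> fintype.lift i 3 = m ->
    beta (<< (-1) ^+ i *g face i p >> : chain C 3) =
    if o then - tangent_sum (v j) (v k) (v l) (v m)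
    else tangent_sum (v j) (v k) (v l) (v m).
  move=> <- <- <- <- <-.
  pose w n := v (fintype.lift i n).
  have fw n : S3_line (val (face i p) n) = <[w n]>%VS.
    have -> : val (face i p) n = q (fintype.lift i n) by rewrite [LHS]ffunE.
    exact: qv.
  rewrite /beta fgextUz (beta0_tangent (gtupleP (face i p)) fw) -signr_odd.
  by case: (odd i); rewrite ?expr1 ?expr0 ?mulrN1z ?mulr1z.
have sum5 (F : 'I_5 -> preBloch C) :
    \sum_(i < 5) F i = F 0 + F 1 + F 2 + F 3 + F 4.
  rewrite !big_ord_recl big_ord0 addr0 !addrA.
  by congr (F _ + F _ + F _ + F _ + F _); exact: val_inj.
rewrite /bd fgextU raddf_sum.
apply: etrans
  (sum5 (fun i => beta (<< (-1) ^+ i *g face i p >> : chain C 3))) _.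
rewrite (faceE 0 false 1 2 3 4 erefl); try exact: val_inj.
rewrite (faceE 1 true 0 2 3 4 erefl); try exact: val_inj.
rewrite (faceE 2 false 0 1 3 4 erefl); try exact: val_inj.
rewrite (faceE 3 true 0 1 2 4 erefl); try exact: val_inj.
rewrite (faceE 4 false 0 1 2 3 erefl); try exact: val_inj.
apply: tangent_sum_five => /=.
- by rewrite !vv.
- by rewrite !hn.
- by rewrite !dn.
Qed.

Theorem lemma3p2 (R : realType) :
  (@betabar R[i] @` range (@dbar R[i] 3) = [set 0]) /\
  (exists c : {additive chainG_coker R[i] 3 -> preBloch R[i]},
     forall x : chainG R[i] 3,
       c (\pi_(chainG_coker R[i] 3) x) = betabar x).
Proof.
have bd0 y : betabar (@dbar R[i] 3 y) = 0.
  elim/quotW: y => x; rewrite dbarE.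
  exact: etrans (abquot_mapE (@beta_coinv R[i]) (bd x)) (beta_bd x).
have fA a : range (@dbar R[i] 3) a -> betabar a = 0 by case=> y _ <-.
split.
  apply/seteqP; split=> [_ [_ [y _ <-] <-]|_ ->] /=; first exact: bd0.
  (* Equality with [[set 0]] also asks that 0 be attained. *)
  by exists (dbar 0); [exists 0|exact: bd0].
pose cm := GRing.isZmodMorphism.Build _ _
  (abquot_map (@betabar R[i])) (abquot_map_zmod_morphism fA).
pose c : {additive chainG_coker R[i] 3 -> preBloch R[i]} :=
  HB.pack (abquot_map (@betabar R[i])) cm.
by exists c => x; exact: (abquot_mapE fA).
Qed.
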